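(* For every $\varepsilon>0$ there is an algorithm running in time polynomial in $n$ and $1/\varepsilon$ that, given any instance of Max Min Agreements on a general graph with arbitrary non-negative edge weights, outputs a clustering $\mathcal S$ with $\min_{u\in V}\mathrm{agree}_{\mathcal S}(u)\ge \frac{1}{2+\varepsilon}\,\mathrm{OPT}$, where $\mathrm{OPT}=\max_{\mathcal S'}\min_{u\in V}\mathrm{agree}_{\mathcal S'}(u)$.
   Context: An instance consists of an undirected graph $G=(V,E)$, $n=|V|$, non-negative edge weights $c:E\to\mathbb R_{\ge0}$, and a partition of $E$ into $E^+$ and $E^-$. A clustering is a partition $\mathcal S=\{S_1,\dots,S_\ell\}$ of $V$ into an arbitrary number of parts. For $u\in S_i$, $\mathrm{agree}_{\mathcal S}(u)=\sum_{v\in S_i,(u,v)\in E^+}c_{u,v}+\sum_{v\notin S_i,(u,v)\in E^-}c_{u,v}$. Max Min Agreements asks for a clustering maximizing $\min_{u\in V}\mathrm{agree}_{\mathcal S}(u)$. *)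

(* Defs.v *)
From HB Require Import structures.
From mathcomp Require Import all_boot all_order all_algebra.
From mathcomp Require Import reals.

Set Implicit Arguments.
Unset Strict Implicit.
Unset Printing Implicit Defensive.

Import Order.TTheory GRing.Theory Num.Theory.
Local Open Scope ring_scope.

(** * Max Min Agreements *)

(* The undirected edge (u, v) is the two-element set [set u; v].  Only the
   values of weight on edges are meaningful.  finset's partition is not used
   for the splitting of the edge set, as pos or neg may be empty. *)
Record instance (R : realType) (V : finType) := Instance {
  edge : {set {set V}};
  edge_card2 : forall e, e \in edge -> #|e| = 2;
  pos : {set {set V}};
  neg : {set {set V}};
  pos_neg_cover : pos :|: neg = edge;
  pos_neg_disjoint : [disjoint pos & neg];
  weight : {set V} -> R;
  weight_ge0 : forall e, e \in edge -> 0 <= weight e }.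

Definition clustering (V : finType) (S : {set {set V}}) : bool :=
  partition S [set: V].

Definition agree (R : realType) (V : finType) (I : instance R V)
    (S : {set {set V}}) (u : V) : R :=
  \sum_(v | (v \in pblock S u) && ([set u; v] \in pos I)) weight I [set u; v]
  + \sum_(v | (v \notin pblock S u) && ([set u; v] \in neg I))
      weight I [set u; v].

(* The vertex set is 'I_n.+1, as the minimum needs a nonempty range.  The index
   element of each big operator below is itself one of the values ranged over,
   so these are a genuine minimum and a genuine maximum (see min_agree_attained
   and opt_attained). *)
Definition min_agree (R : realType) (n : nat) (I : instance R 'I_n.+1)
    (S : {set {set 'I_n.+1}}) : R :=
  \big[Order.min/agree I S ord0]_(u < n.+1) agree I S u.

Definition opt (R : realType) (n : nat) (I : instance R 'I_n.+1) : R :=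
  \big[Order.max/min_agree I [set [set: 'I_n.+1]]]_(S | clustering S)
    min_agree I S.

Lemma clustering1 (n : nat) : clustering [set [set: 'I_n.+1]].
Proof.
apply/and3P; split; first by rewrite /cover big_set1.
- by apply/trivIsetP => A B /set1P-> /set1P->; rewrite eqxx.
- by rewrite inE; apply/eqP => /setP/(_ ord0); rewrite !inE.
Qed.

Lemma min_agree_le (R : realType) (n : nat) (I : instance R 'I_n.+1) S u :
  min_agree I S <= agree I S u.
Proof. exact: bigmin_le_cond. Qed.

Lemma min_agree_attained (R : realType) (n : nat) (I : instance R 'I_n.+1) S :
  exists u, min_agree I S = agree I S u.
Proof.
rewrite /min_agree; elim/big_ind: _ => [|x y [u ->] [v ->]|u _].
- by exists ord0.
- by case: (leP (agree I S u) (agree I S v)) => _; [exists u | exists v].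
- by exists u.
Qed.

Lemma opt_ge (R : realType) (n : nat) (I : instance R 'I_n.+1) S :
  clustering S -> min_agree I S <= opt I.
Proof. exact: le_bigmax_cond. Qed.

Lemma opt_attained (R : realType) (n : nat) (I : instance R 'I_n.+1) :
  exists2 S, clustering S & opt I = min_agree I S.
Proof.
rewrite /opt; elim/big_ind: _ => [|x y [S cS ->] [T cT ->]|S cS].
- by exists [set [set: 'I_n.+1]] => //; exact: clustering1.
- by case: (leP (min_agree I S) (min_agree I T)) => _; [exists T | exists S].
- by exists S.
Qed.

(** * Algorithms: a real RAM with structured control flow *)

(* Programs are independent of R: the only constants are natural numbers, so no
   information can be hidden in a real literal.  Registers are named by
   literals; memory is reached only through addresses held in integer
   registers.  Each of these instructions costs one time unit, as does each test
   (see exec).  As usual for a unit-cost real RAM there is no floor or other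
   conversion from reals to integers; there is no integer multiplication
   either. *)
Inductive instr :=
| IConst of nat & nat          (* i_k := m *)
| IAdd of nat & nat & nat      (* i_k := i_a + i_b *)
| ISub of nat & nat & nat      (* i_k := i_a - i_b, truncated *)
| ILoad of nat & nat           (* i_k := imem[i_a] *)
| IStore of nat & nat          (* imem[i_a] := i_k *)
| RConst of nat & nat          (* x_k := m *)
| RAdd of nat & nat & nat      (* x_k := x_a + x_b *)
| RSub of nat & nat & nat      (* x_k := x_a - x_b *)
| RMul of nat & nat & nat      (* x_k := x_a * x_b *)
| RDiv of nat & nat & nat      (* x_k := x_a / x_b, with x / 0 = 0 *)
| RLoad of nat & nat           (* x_k := xmem[i_a] *)
| RStore of nat & nat.         (* xmem[i_a] := x_k *)

Inductive test :=
| ILt of nat & nat             (* i_a < i_b *)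
| RLt of nat & nat.            (* x_a < x_b *)

Inductive program :=
| Skip
| Do of instr
| Seq of program & program
| If of test & program & program
| While of test & program.

Record state (R : realType) := State {
  ireg : nat -> nat;
  imem : nat -> nat;
  xreg : nat -> R;
  xmem : nat -> R }.

Definition run_instr (R : realType) (c : instr) (s : state R) : state R :=
  let: State i im x xm := s in
  match c with
  | IConst k m => State [eta i with k |-> m] im x xm
  | IAdd k a b => State [eta i with k |-> (i a + i b)%N] im x xm
  | ISub k a b => State [eta i with k |-> (i a - i b)%N] im x xm
  | ILoad k a => State [eta i with k |-> im (i a)] im x xm
  | IStore a k => State i [eta im with i a |-> i k] x xm
  | RConst k m => State i im [eta x with k |-> m%:R] xm
  | RAdd k a b => State i im [eta x with k |-> x a + x b] xm
  | RSub k a b => State i im [eta x with k |-> x a - x b] xm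
  | RMul k a b => State i im [eta x with k |-> x a * x b] xm
  | RDiv k a b => State i im [eta x with k |-> x a / x b] xm
  | RLoad k a => State i im [eta x with k |-> xm (i a)] xm
  | RStore a k => State i im x [eta xm with i a |-> x k]
  end.

Definition run_test (R : realType) (b : test) (s : state R) : bool :=
  match b with
  | ILt a b => (ireg s a < ireg s b)%N
  | RLt a b => xreg s a < xreg s b
  end.

(* exec P s t s' : started in s, P halts after exactly t time units in s'. *)
Inductive exec (R : realType) : program -> state R -> nat -> state R -> Prop :=
| ExecSkip s : exec Skip s 0 s
| ExecDo c s : exec (Do c) s 1 (run_instr c s)
| ExecSeq P Q s s1 s2 t1 t2 :
    exec P s t1 s1 -> exec Q s1 t2 s2 -> exec (Seq P Q) s (t1 + t2) s2
| ExecIfTrue b P Q s s1 t :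
    run_test b s -> exec P s t s1 -> exec (If b P Q) s t.+1 s1
| ExecIfFalse b P Q s s1 t :
    ~~ run_test b s -> exec Q s t s1 -> exec (If b P Q) s t.+1 s1
| ExecWhileTrue b P s s1 s2 t1 t2 :
    run_test b s -> exec P s t1 s1 -> exec (While b P) s1 t2 s2 ->
    exec (While b P) s (t1 + t2).+1 s2
| ExecWhileFalse b P s :
    ~~ run_test b s -> exec (While b P) s 1 s.

Lemma exec_deterministic (R : realType) P (s : state R) t1 t2 s1 s2 :
  exec P s t1 s1 -> exec P s t2 s2 -> t1 = t2 /\ s1 = s2.
Proof.
move=> e1; elim: e1 t2 s2 => {P s t1 s1}
  [s|c s|P Q s s1 s2 t1 t2 _ IH1 _ IH2|b P Q s s1 t bs _ IH|b P Q s s1 t bs _ IH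
  |b P s s1 s2 t1 t2 bs _ IH1 _ IH2|b P s bs] t' s' e2;
  inversion e2; subst=> //;
  try (by match goal with H1 : is_true ?x, H2 : is_true (~~ ?x) |- _ =>
         rewrite H1 in H2 end).
- have [? ?] := IH1 _ _ ltac:(eassumption); subst.
  by have [-> ->] := IH2 _ _ ltac:(eassumption).
- by have [-> ->] := IH _ _ ltac:(eassumption).
- by have [-> ->] := IH _ _ ltac:(eassumption).
- have [? ?] := IH1 _ _ ltac:(eassumption); subst.
  by have [-> ->] := IH2 _ _ ltac:(eassumption).
Qed.

(** * Input and output conventions *)

Definition row_major (T : Type) (x0 : T) (n : nat) (f : 'I_n -> 'I_n -> T)
    (a : nat) : T :=
  nth x0 [seq f u v | u <- enum 'I_n, v <- enum 'I_n] a.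

Lemma row_majorE (T : Type) (x0 : T) (n : nat) (f : 'I_n -> 'I_n -> T)
    (u v : 'I_n) :
  row_major x0 f (u * n + v) = f u v.
Proof.
rewrite /row_major; set ss := [seq [seq f w z | z <- enum 'I_n] | w <- enum 'I_n].
have sh : shape ss = nseq n n.
  have -> : shape ss = nseq (size (enum 'I_n)) n.
    rewrite /ss; elim: {2 3}(enum 'I_n) => //= w s ->.
    by rewrite size_map size_enum_ord.
  by rewrite size_enum_ord.
have vn : (v < nth 0 (shape ss) u)%N by rewrite sh nth_nseq ltn_ord.
have -> : (u * n + v)%N = flatten_index (shape ss) u v.
  by rewrite /flatten_index sh take_nseq ?(ltnW (ltn_ord u)) // sumn_nseq mulnC.
rewrite nth_flatten flatten_indexKl // flatten_indexKr //.
rewrite (nth_map u) ?size_enum_ord // nth_ord_enum.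
by rewrite (nth_map v) ?size_enum_ord // nth_ord_enum.
Qed.

(* Adjacency-matrix input.  Register i_0 holds the number n of vertices.  For
   u, v < n, cell u * n + v holds in imem the code 1 if (u, v) is in E^+, 2 if
   it is in E^-, 0 if it is not an edge, and in xmem the weight of (u, v), or 0
   if it is not an edge.  Everything else is 0. *)
Definition init (R : realType) (n : nat) (I : instance R 'I_n) : state R :=
  State
    [eta (fun=> 0%N) with 0%N |-> n]
    (row_major 0%N (fun u v =>
       if [set u; v] \in pos I then 1%N
       else if [set u; v] \in neg I then 2%N else 0%N))
    (fun=> 0)
    (row_major 0 (fun u v =>
       if [set u; v] \in edge I then weight I [set u; v] else 0)).

(* The final contents of imem[v] is the name of the cluster of v. *)
Definition output (R : realType) (n : nat) (s : state R) : {set {set 'I_n}} :=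
  preim_partition (fun v : 'I_n => imem s v) [set: 'I_n].

(* Main.v *)
Require Import Defs.
From mathcomp Require Import all_boot all_order all_algebra.
From mathcomp Require Import reals ring lra zify.
Set Implicit Arguments.
Unset Strict Implicit.
Unset Printing Implicit Defensive.
Import Order.TTheory GRing.Theory Num.Theory.
Local Open Scope ring_scope.

(* OPT is at most D, the least total weight at a vertex.  Capping every weight at
   D leaves at least D at each vertex.  Starting from one cluster, move a vertex
   to the other of two clusters whenever its capped agreement a is bad, that is,
   a * (2K + 1) < K * D, for a natural number K > 1 / eps.  A move exchanges the
   agreeing and the disagreeing weight at the vertex, so it raises the total
   capped agreement by at least D / (2K + 1).  Thanks to the capping this total
   is at most n^2 * D, hence there are at most n^2 * (2K + 1) moves, after which
   every agreement is at least D / (2 + 1 / K). *)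

(** * Total correctness rules with a time budget *)

Local Coercion Do : instr >-> program.

Local Notation "P ;; Q" := (Seq P Q)
  (at level 90, right associativity, format "P ;;  '/' Q").

(* T is a budget: P runs within it, and Q receives some of what is left. *)
Definition wp (R : realType) (P : program) (Q : nat -> state R -> Prop)
    (T : nat) (s : state R) : Prop :=
  exists t s' T', [/\ exec P s t s', (t + T' <= T)%N & Q T' s'].

Lemma wp_seq (R : realType) P P' (Q : nat -> state R -> Prop) T s :
  wp P (wp P' Q) T s -> wp (P ;; P') Q T s.
Proof.
move=> [t [s' [T' [e le [t1 [s1 [T1 [e1 le1 q]]]]]]]].
exists (t + t1)%N, s1, T1; split=> //; first exact: ExecSeq e e1.
by rewrite -addnA; apply: leq_trans le; rewrite leq_add2l.
Qed.

Lemma wp_do (R : realType) c (Q : nat -> state R -> Prop) T s :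
  Q T (run_instr c s) -> wp c Q T.+1 s.
Proof.
by move=> q; exists 1%N, (run_instr c s), T; split=> //; exact: ExecDo.
Qed.

Lemma wp_skip (R : realType) (Q : nat -> state R -> Prop) T T' s :
  (T' <= T)%N -> Q T' s -> wp Skip Q T s.
Proof. by move=> le q; exists 0%N, s, T'; split=> //; exact: ExecSkip. Qed.

Ltac step :=
  first [apply: wp_seq; apply: wp_do | apply: wp_do] => /=.

Lemma wp_if (R : realType) b P P' (Q : nat -> state R -> Prop) T s :
  (run_test b s -> wp P Q T s) -> (~~ run_test b s -> wp P' Q T s) ->
  wp (If b P P') Q T.+1 s.
Proof.
move=> w w'; case bs: (run_test b s).
  have [t [s' [T' [e le q]]]] := w bs.
  by exists t.+1, s', T'; split=> //; exact: ExecIfTrue.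
have [t [s' [T' [e le q]]]] := w' (negbT bs).
by exists t.+1, s', T'; split=> //; apply: ExecIfFalse => //; rewrite bs.
Qed.

(** The index [m] of the invariant bounds the number of iterations still to come. Each costs at most
    [C] for the body and one unit for its test; the last, failing test costs one more, and [T] is
    left for what follows. *)
Lemma wp_while (R : realType) (J : nat -> state R -> Prop) C b P
    (Q : nat -> state R -> Prop) m T s :
  (forall m s, J m s -> run_test b s ->
     wp P (fun _ s' => exists2 m', (m' < m)%N & J m' s') C s) ->
  (forall m s, J m s -> ~~ run_test b s -> Q T s) ->
  J m s -> wp (While b P) Q ((m * C.+1).+1 + T) s.
Proof.
move=> step fin; elim/ltn_ind: m s => m IH s Jm.
case bs: (run_test b s); last first.
  exists 1%N, s, T; split; last exact: fin Jm (negbT bs).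
    by apply: ExecWhileFalse; rewrite bs.
  by rewrite add1n ltnS leq_addl.
have [t [s1 [T1 [e le [m' m'm Jm']]]]] := step _ _ Jm bs.
have [t2 [s2 [T2 [e2 le2 q]]]] := IH _ m'm _ Jm'.
exists (t + t2).+1, s2, T2; split=> //; first exact: ExecWhileTrue e e2.
have := leq_mul m'm (leqnn C.+1); rewrite mulSn => ?; lia.
Qed.

Lemma wp_for (R : realType) (J : nat -> state R -> Prop) C i k n P
    (Q : nat -> state R -> Prop) T s :
  (forall j s, J j s -> [/\ ireg s i = j, ireg s k = n & (j <= n)%N]) ->
  (forall j s, (j < n)%N -> J j s -> wp P (fun _ => J j.+1) C s) ->
  (forall s, J n s -> Q T s) ->
  J 0%N s -> wp (While (ILt i k) P) Q ((n * C.+1).+1 + T) s.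
Proof.
move=> reg step fin J0.
apply: (@wp_while R (fun m s => exists2 j, (j + m = n)%N & J j s)) => //.
- move=> m s' [j jm Js] /=; have [-> -> _] := reg _ _ Js => jn.
  have [t [s1 [T1 [e le q]]]] := step _ _ jn Js.
  exists t, s1, T1; split=> //; exists m.-1; first by lia.
  by exists j.+1 => //; lia.
- move=> m s' [j jm Js] /=; have [-> -> jn] := reg _ _ Js; rewrite -leqNgt => nj.
  by apply: fin; have -> : n = j by lia.
- by exists 0%N.
Qed.

(** * Inner loops: row sums, the bound D, and the capped agreement of one vertex *)

Definition same_except (ks : seq nat) (T : Type) (f g : nat -> T) : Prop :=
  forall k, k \notin ks -> f k = g k.

Lemma same_except_set (ks : seq nat) (T : Type) (f g : nat -> T) k y :
  k \in ks -> same_except ks f g -> same_except ks [eta f with k |-> y] g.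
Proof.
move=> kks fg j jks /=; case: eqP => [jk|_]; last exact: fg.
by rewrite jk kks in jks.
Qed.

(* Integer registers: 0 is n, 1 is the constant 1, 12 the constant 0, 2 and 3 are
   the vertices u and v, 4 is the address of the entry (u, v), 5 is n * n, where
   the labels (0 or 1) of the two clusters start, 6 is the address of a label, 7
   and 8 are the labels of u and v.  Real registers: 0 is D, 1 an accumulator, 2
   the weight of (u, v), 3 the constant 0, 4 is K * D and 5 is 2 * K + 1. *)
Definition row_sum_loop : program :=
  While (ILt 3 0) (RLoad 2 4;; RAdd 1 1 2;; IAdd 4 4 1;; IAdd 3 3 1).

Lemma wp_row_sum (R : realType) (Q : nat -> state R -> Prop) n p T
    (s : state R) :
  ireg s 0 = n -> ireg s 1 = 1%N -> ireg s 3 = 0%N -> ireg s 4 = p ->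
  xreg s 1 = 0 ->
  (forall i x, same_except [:: 3; 4]%N i (ireg s) ->
     same_except [:: 1; 2]%N x (xreg s) ->
     i 4%N = (p + n)%N -> x 1%N = \sum_(v < n) xmem s (p + v)%N ->
     Q T (State i (imem s) x (xmem s))) ->
  wp row_sum_loop Q ((n * 5).+1 + T) s.
Proof.
move=> i0 i1 i3 i4 x1 q.
pose J j (s' : state R) := let: State i im x xm := s' in
  [/\ im = imem s, xm = xmem s, same_except [:: 3; 4]%N i (ireg s),
      same_except [:: 1; 2]%N x (xreg s) &
      [/\ i 3%N = j, i 4%N = (p + j)%N, (j <= n)%N &
          x 1%N = \sum_(v < j) xm (p + v)%N]].
apply: (@wp_for R J 4 3 0 n).
- move=> j [i im x xm] /= [_ _ fi _ [-> _ jn _]]; split=> //.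
  by rewrite fi.
- move=> j [i im x xm] jn [e1 e2 fi fx [r3 r4 _ rx]].
  have r1 : i 1%N = 1%N by rewrite fi.
  do 4 step; split=> //.
  + by do 2 (apply: same_except_set => //).
  + by do 2 (apply: same_except_set => //).
  + by rewrite r1 r3 r4 rx big_ord_recr /= !addn1 addnS.
- move=> [i im x xm] [-> -> fi fx [r3 r4 _ rx]]; exact: q.
- case: s i0 i1 i3 i4 x1 q @J => i im x xm /= i0 i1 i3 i4 x1 q.
  by rewrite i3 i4 addn0 x1 big_ord0.
Qed.

(** Real register 3 is 0, so [RAdd 0 1 3] is a copy. The test [ILt 2 1] recognizes row 0, which
    initializes the minimum. The address in register 4 is never reset: it runs on from row to
    row. *)
Definition min_row_loop : program :=
  While (ILt 2 0)
    (IConst 3 0;; RConst 1 0;; row_sum_loop;;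
     If (ILt 2 1) (RAdd 0 1 3) (If (RLt 1 0) (RAdd 0 1 3) Skip);;
     IAdd 2 2 1).

Lemma wp_min_row (R : realType) (Q : nat -> state R -> Prop) n T
    (s : state R) :
  let row u := \sum_(v < n) xmem s (u * n + v)%N in
  (0 < n)%N ->
  ireg s 0 = n -> ireg s 1 = 1%N -> ireg s 2 = 0%N -> ireg s 4 = 0%N ->
  xreg s 3 = 0 ->
  (forall i x, same_except [:: 2; 3; 4]%N i (ireg s) ->
     same_except [:: 0; 1; 2]%N x (xreg s) -> i 4%N = (n * n)%N ->
     (forall u, (u < n)%N -> x 0%N <= row u) ->
     (exists2 u, (u < n)%N & x 0%N = row u) ->
     Q T (State i (imem s) x (xmem s))) ->
  wp min_row_loop Q ((n * ((n * 5).+1 + 4).+3).+1 + T) s.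
Proof.
move=> row n0 i0 i1 i2 i4 x3 q.
pose J j (s' : state R) := let: State i im x xm := s' in
  [/\ im = imem s, xm = xmem s, same_except [:: 2; 3; 4]%N i (ireg s),
      same_except [:: 0; 1; 2]%N x (xreg s) &
      [/\ i 2%N = j, i 4%N = (j * n)%N, (j <= n)%N,
          (forall u, (u < j)%N -> x 0%N <= row u) &
          (0 < j)%N -> exists2 u, (u < j)%N & x 0%N = row u]].
apply: (@wp_for R J ((n * 5).+1 + 4).+2 2 0 n).
- move=> j [i im x xm] /= [_ _ fi _ [-> _ jn _ _]]; split=> //.
  by rewrite fi.
- move=> j [i im x xm] jn [e1 e2 fi fx [r2 r4 _ rm ra]].
  have r1 : i 1%N = 1%N by rewrite fi.
  do 2 step; apply: wp_seq.
  apply: (@wp_row_sum _ _ n (j * n)) => //=; first by rewrite fi.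
  move=> i' x' fi' fx' i'4 x'1.
  have x'3 : x' 3%N = 0 by rewrite fx' //= fx.
  have i'2 : i' 2%N = j by rewrite fi' //= r2.
  have i'1 : i' 1%N = 1%N by rewrite fi' //= r1.
  have x'0 : x' 0%N = x 0%N by rewrite fx'.
  have fi2 : same_except [:: 2; 3; 4]%N i' (ireg s).
    move=> k; rewrite !inE !negb_or => /and3P[k2 k3 k4].
    by rewrite fi' ?inE ?negb_or ?k3 //= (negPf k3) fi // !inE !negb_or k2 k3.
  have fx2 : same_except [:: 0; 1; 2]%N x' (xreg s).
    move=> k; rewrite !inE !negb_or => /and3P[k0 k1 k2].
    by rewrite fx' ?inE ?negb_or ?k1 //= (negPf k1) fx // !inE !negb_or k0 k1.
  have x'r : x' 1%N + x' 3%N = row j by rewrite x'3 addr0 x'1 e2.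
  (* The three branches of the program differ only in whether row [j] replaces the current minimum,
     which [b] records. *)
  have new (b : bool) (y : R) : (b -> y = row j) -> (~~ b -> y = x 0%N) ->
      (b -> forall u, (u < j)%N -> row j <= row u) ->
      (~~ b -> (0 < j)%N /\ x 0%N <= row j) ->
      (forall u, (u < j.+1)%N -> y <= row u) /\
      (exists2 u, (u < j.+1)%N & y = row u).
    case: b => [/(_ isT)-> _ /(_ isT) le _|_ /(_ isT)-> _ /(_ isT)[j0 le]].
      split; last by exists j.
      by move=> u; rewrite ltnS leq_eqVlt => /predU1P[-> //|/le].
    split; last by have [u uj ->] := ra j0; exists u; rewrite // ltnW.
    by move=> u; rewrite ltnS leq_eqVlt => /predU1P[-> //|/rm].
  have r4' : i' 4%N = (j.+1 * n)%N by rewrite i'4 mulSn addnC.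
  apply: wp_seq; apply: wp_if => /=.
    rewrite i'1 i'2 ltnS leqn0 => /eqP j0; do 2 step.
    have [|||| le at_] := new true (row j) => //; first by rewrite j0.
    split=> //; try by apply: same_except_set.
    by split=> //; rewrite ?i'1 ?i'2 ?addn1 ?x'r //.
  rewrite i'1 i'2 -leqNgt => j0; apply: wp_if => /=.
    rewrite x'0 x'1 => lt; do 2 step.
    have [|||| le at_] := new true (row j) => //.
      move=> _ u uj.
      by apply: le_trans (rm _ uj); rewrite -x'r x'3 addr0 x'1; exact: ltW.
    split=> //; try by apply: same_except_set.
    by split=> //; rewrite ?i'1 ?i'2 ?addn1 ?x'r //.
  rewrite x'0 x'1 -leNgt => ge; apply: (wp_skip (leqnn _)); step.
  have [|||| le at_] := new false (x 0%N) => //.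
    by split=> //; rewrite -x'r x'3 addr0 x'1.
  split=> //; try by apply: same_except_set.
  by split=> //; rewrite ?i'1 ?i'2 ?addn1 ?x'0 //.
- move=> [i im x xm] [-> -> fi fx [r2 r4 _ rm ra]]; apply: q => //.
  exact: ra.
- move: i0 i1 i2 i4 x3; rewrite /J /row; case: (s) => i im x xm /= *.
  by do 2 (split=> //).
Qed.

Definition cap_weight : program := If (RLt 2 0) Skip (RAdd 2 0 3).

Lemma wp_cap_weight (R : realType) (Q : nat -> state R -> Prop) T s :
  xreg s 3 = 0 ->
  (forall x, same_except [:: 2]%N x (xreg s) ->
     x 2%N = Order.min (xreg s 2) (xreg s 0) ->
     Q T (State (ireg s) (imem s) x (xmem s))) ->
  wp cap_weight Q T.+2 s.
Proof.
case: s => i im x xm /= x3 q; apply: wp_if => /= lt.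
  by apply: (@wp_skip _ _ _ T) => //; apply: q => //; rewrite min_l // ltW.
apply: wp_do; apply: q => /=; first exact: same_except_set.
by rewrite x3 addr0 min_r // leNgt.
Qed.

Definition add_if_equal : program :=
  If (ILt 9 11) Skip (If (ILt 11 9) Skip (RAdd 1 1 2)).

Lemma wp_add_if_equal (R : realType) (Q : nat -> state R -> Prop) T s :
  (forall x, same_except [:: 1]%N x (xreg s) ->
     x 1%N = xreg s 1 + (if ireg s 11 == ireg s 9 then xreg s 2 else 0) ->
     Q T (State (ireg s) (imem s) x (xmem s))) ->
  wp add_if_equal Q T.+3 s.
Proof.
case: s => i im x xm /= q.
apply: wp_if => /= [lt|ge].
  apply: (@wp_skip _ _ _ T); first by lia.
  by apply: q => //; rewrite gtn_eqF // addr0.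
apply: wp_if => /= [lt|le].
  apply: (@wp_skip _ _ _ T) => //.
  by apply: q => //; rewrite ltn_eqF // addr0.
apply: wp_do; apply: q => /=; first exact: same_except_set.
by rewrite eqn_leq leqNgt ge leqNgt le.
Qed.

(* The code of (u, v) is 1 + |l_u - l_v| exactly when (u, v) agrees with l. *)
Definition agree_loop : program :=
  While (ILt 3 0)
    (ILoad 8 6;; ILoad 11 4;; RLoad 2 4;;
     cap_weight;;
     ISub 9 7 8;; ISub 10 8 7;; IAdd 9 9 10;; IAdd 9 9 1;;
     add_if_equal;;
     IAdd 4 4 1;; IAdd 6 6 1;; IAdd 3 3 1).

(** Labels are arbitrary numbers here. One of the two truncated differences vanishes, so [d] is
    their absolute difference; on labels 0 and 1 it is the exclusive or used in [capped_agree]. *)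
Lemma wp_agree (R : realType) (Q : nat -> state R -> Prop) n p q T
    (s : state R) :
  let term v :=
    let d := (ireg s 7 - imem s (q + v) + (imem s (q + v) - ireg s 7))%N in
    if imem s (p + v)%N == d.+1 then Order.min (xmem s (p + v)%N) (xreg s 0)
    else 0 in
  ireg s 0 = n -> ireg s 1 = 1%N -> ireg s 3 = 0%N -> ireg s 4 = p ->
  ireg s 6 = q -> xreg s 1 = 0 -> xreg s 3 = 0 ->
  (forall i x, same_except [:: 3; 4; 6; 8; 9; 10; 11]%N i (ireg s) ->
     same_except [:: 1; 2]%N x (xreg s) -> i 4%N = (p + n)%N ->
     x 1%N = \sum_(v < n) term v ->
     Q T (State i (imem s) x (xmem s))) ->
  wp agree_loop Q ((n * 16).+1 + T) s.
Proof.
move=> term i0 i1 i3 i4 i6 x1 x3 qq.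
pose J j (s' : state R) := let: State i im x xm := s' in
  [/\ im = imem s, xm = xmem s,
      same_except [:: 3; 4; 6; 8; 9; 10; 11]%N i (ireg s),
      same_except [:: 1; 2]%N x (xreg s) &
      [/\ i 3%N = j, i 4%N = (p + j)%N, i 6%N = (q + j)%N, (j <= n)%N &
      x 1%N = \sum_(v < j) term v]].
apply: (@wp_for R J 15 3 0 n).
- move=> j [i im x xm] /= [_ _ fi _ [-> _ _ jn _]]; split=> //.
  by rewrite fi.
- move=> j [i im x xm] jn [e1 e2 fi fx [r3 r4 r6 _ rx]].
  have r1 : i 1%N = 1%N by rewrite fi.
  have r7 : i 7%N = ireg s 7 by rewrite fi.
  have xr0 : x 0%N = xreg s 0 by rewrite fx.
  have xr3 : x 3%N = 0 by rewrite fx.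
  do 3 step; apply: wp_seq; apply: wp_cap_weight => //= x' fx' x'2.
  do 4 step; apply: wp_seq; apply: wp_add_if_equal => /= x'' fx'' x''1.
  do 3 step; split=> //; try by do 9 (apply: same_except_set => //).
    move=> k; rewrite !inE negb_or => /andP[k1 k2].
    rewrite fx'' ?inE // fx' ?inE //= (negPf k2) fx // !inE negb_or k1 //.
  rewrite r1 r3 r4 r6 !addn1 !addnS; split=> //.
  by rewrite x''1 fx' //= x'2 big_ord_recr /= rx r1 r7 r4 r6 xr0 e1 e2 addn1.
- move=> [i im x xm] [-> -> fi fx [r3 r4 _ _ rx]]; exact: qq.
- move: i0 i1 i3 i4 i6 x1 x3; rewrite /J /term; case: (s) => i im x xm /= *.
  by split=> //; split=> //; rewrite ?addn0 // big_ord0.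
Qed.

(** * The potential and its change under a move *)

(** Code 1 stands for a positive edge and 2 for a negative one, so the test accepts positive edges
    inside a cluster and negative edges across, and rejects code 0. *)
Definition capped_agree (R : realType) (V : finType) (code : V -> V -> nat)
    (w : V -> V -> R) (D : R) (l : V -> bool) (u v : V) : R :=
  if code u v == (l u (+) l v).+1 then Order.min (w u v) D else 0.

Definition potential (R : realType) (V : finType) (code : V -> V -> nat)
    (w : V -> V -> R) (D : R) (l : V -> bool) : R :=
  \sum_u \sum_v capped_agree code w D l u v.

Definition flip (V : eqType) (l : V -> bool) (u : V) : V -> bool :=
  fun v => if v == u then ~~ l v else l v.

Lemma capped_agree_ge0 (R : realType) (V : finType) code (w : V -> V -> R) D l
    u v :
  0 <= D -> (forall x y, 0 <= w x y) -> 0 <= capped_agree code w D l u v.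
Proof.
by move=> D0 w0; rewrite /capped_agree; case: ifP; rewrite // le_min w0.
Qed.

Lemma potential_ge0 (R : realType) (V : finType) code (w : V -> V -> R) D l :
  0 <= D -> (forall x y, 0 <= w x y) -> 0 <= potential code w D l.
Proof.
by move=> D0 w0; do 2 (apply: sumr_ge0 => ? _); exact: capped_agree_ge0.
Qed.

Lemma potential_le (R : realType) (V : finType) code (w : V -> V -> R) D l :
  0 <= D -> potential code w D l <= (#|V| * #|V|)%:R * D.
Proof.
move=> D0; have row u : \sum_v capped_agree code w D l u v <= D *+ #|V|.
  rewrite -sumr_const; apply: ler_sum => v _.
  by rewrite /capped_agree; case: ifP; rewrite ?ge_min ?lexx ?orbT.
apply: le_trans (ler_sum _ (fun u _ => row u)) _.
by rewrite sumr_const -mulrnA mulr_natl.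
Qed.

(** Either some weight reaches [D], and its capped value alone suffices, or capping changes no
    weight at all. *)
Lemma capped_row_ge (R : realType) (V : finType) (w : V -> R) D :
  0 <= D -> (forall v, 0 <= w v) -> D <= \sum_v w v ->
  D <= \sum_v Order.min (w v) D.
Proof.
move=> D0 w0 Dw; case: (pickP (fun v => D <= w v)) => [v Dv|small].
  rewrite (bigD1 v) //= min_r // ler_wpDr // sumr_ge0 // => y _.
  by rewrite le_min w0.
apply: le_trans Dw _; apply: ler_sum => v _; rewrite min_l //.
by rewrite ltW // ltNge small.
Qed.

(** Only row and column [u] of the matrix of capped agreements change. In row [u] agreeing and
    disagreeing entries trade places, which changes the row sum from a to M - a, where M is the
    capped weight at [u]. By symmetry the column changes by as much, whence the outer factor 2. *)
Lemma potential_flip (R : realType) (V : finType) code (w : V -> V -> R) D l u :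
  0 <= D ->
  (forall x y, code x y = code y x) -> (forall x y, w x y = w y x) ->
  (forall x y, code x y != 1%N -> code x y != 2%N -> w x y = 0) ->
  w u u = 0 ->
  potential code w D (flip l u) = potential code w D l +
    (\sum_v Order.min (w u v) D - (\sum_v capped_agree code w D l u v) *+ 2) *+ 2.
Proof.
move=> D0 cC wC c12 wuu; apply/eqP; rewrite addrC -subr_eq; apply/eqP.
pose d x y := capped_agree code w D (flip l u) x y - capped_agree code w D l x y.
have min0 : Order.min 0 D = 0 by rewrite min_l.
have dC x y : d x y = d y x.
  by rewrite /d /capped_agree cC wC (addbC (l x)) (addbC (flip l u x)).
have duu : d u u = 0 by rewrite /d /capped_agree wuu min0 !if_same subr0.
have d_row v : d u v = Order.min (w u v) D - capped_agree code w D l u v *+ 2.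
  have [->|vu] := eqVneq v u.
    by rewrite duu /capped_agree wuu min0 if_same mul0rn subr0.
  rewrite /d /capped_agree /flip eqxx (negPf vu) addNb.
  case c1: (code u v == 1%N); last case c2: (code u v == 2%N).
  - by rewrite (eqP c1); case: (l u (+) l v) => /=; rewrite ?mulr2n; ring.
  - by rewrite (eqP c2); case: (l u (+) l v) => /=; rewrite ?mulr2n; ring.
  - by rewrite c12 ?c1 ?c2 // min0 !if_same mul0rn.
have d_off x y : x != u -> y != u -> d x y = 0.
  by move=> xu yu; rewrite /d /capped_agree /flip (negPf xu) (negPf yu) subrr.
have col x : x != u -> \sum_y d x y = d u x.
  move=> xu; rewrite (bigD1 u) //= big1 ?addr0 // => y yu.
  exact: d_off.
have row : \sum_v d u v =
    \sum_v Order.min (w u v) D - (\sum_v capped_agree code w D l u v) *+ 2.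
  by rewrite -sumrMnl -sumrB; apply: eq_bigr => v _.
rewrite /potential -sumrB (eq_bigr (fun x => \sum_y d x y)) => [|x _]; last first.
  by rewrite -sumrB.
(* Every other row changes only in its entry in column [u]; as the diagonal entry contributes 0,
   these changes add up to that of row [u]. *)
rewrite (bigD1 u) //= (eq_bigr _ col) mulr2n -row; congr (_ + _).
by rewrite [RHS](bigD1 u) //= duu add0r.
Qed.

(** * The local search: termination and local optimality *)

(** A move may spoil vertices already checked, so the scan restarts at vertex 0 after it.
    [ISub 7 1 7] flips the label, and [IAdd 6 5 12] is a copy, register 12 being 0. *)
Definition local_search : program :=
  While (ILt 2 0)
    (IAdd 6 5 2;; ILoad 7 6;; IAdd 6 5 12;; IConst 3 0;; RConst 1 0;;
     agree_loop;; RMul 1 1 5;;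
     If (RLt 1 4)
       (ISub 7 1 7;; IAdd 6 5 2;; IStore 6 7;; IConst 2 0;; IConst 4 0)
       (IAdd 2 2 1)).

Lemma wp_local_search (R : realType) (Q : nat -> state R -> Prop) n K T
    (code : 'I_n -> 'I_n -> nat) (w : 'I_n -> 'I_n -> R) D (s : state R) :
  0 <= D ->
  (forall u v, code u v = code v u) -> (forall u v, w u v = w v u) ->
  (forall u v, code u v != 1%N -> code u v != 2%N -> w u v = 0) ->
  (forall u, w u u = 0) -> (forall u v, 0 <= w u v) ->
  (forall u, D <= \sum_v w u v) ->
  ireg s 0 = n -> ireg s 1 = 1%N -> ireg s 2 = 0%N -> ireg s 4 = 0%N ->
  ireg s 5 = (n * n)%N -> ireg s 12 = 0%N ->
  xreg s 0 = D -> xreg s 3 = 0 -> xreg s 4 = K%:R * D -> xreg s 5 = K.*2.+1%:R ->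
  (forall u v : 'I_n, imem s (u * n + v)%N = code u v) ->
  (forall u v : 'I_n, xmem s (u * n + v)%N = w u v) ->
  (forall v : 'I_n, imem s (n * n + v)%N = 0%N) ->
  (forall i (im : nat -> nat) x (l : 'I_n -> bool),
     i 0%N = n -> i 1%N = 1%N -> i 5%N = (n * n)%N ->
     (forall v : 'I_n, im (n * n + v)%N = l v) ->
     (forall u, K%:R * D <= (\sum_v capped_agree code w D l u v) * K.*2.+1%:R) ->
     Q T (State i im x (xmem s))) ->
  wp local_search Q
    (((n * n * K.*2.+1 * n.+1 + n) * ((n * 16).+1 + 7).+1.+4.+1).+1 + T) s.
Proof.
move=> D0 cC wC c12 wuu w0 Drow i0 i1 i2 i4 i5 i12 x0 x3 x4 x5 mc mw ml q.
set F := (n * n * K.*2.+1)%N.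
pose agr l u := \sum_v capped_agree code w D l u v.
pose J m (s' : state R) := let: State i im x xm := s' in
  exists (l : 'I_n -> bool) (f : nat), (* f moves have led to l *)
  [/\ [/\ i 0 = n, i 1 = 1, i 5 = n * n & i 12 = 0]%N,
      [/\ x 0%N = D, x 3%N = 0, x 4%N = K%:R * D & x 5%N = K.*2.+1%:R],
      [/\ forall u v : 'I_n, im (u * n + v)%N = code u v,
          forall v : 'I_n, im (n * n + v)%N = l v & xm = xmem s],
      (* The measure is lexicographic: the moves left, each weighing [n.+1], then the vertices left
         in the current scan. A move resets the second part to [n], which is less than [n.+1]. *)
      [/\ i 4 = i 2 * n, i 2 <= n, f <= F & m = (F - f) * n.+1 + (n - i 2)]%N &
      (forall u : 'I_n, (u < i 2%N)%N -> K%:R * D <= agr l u * K.*2.+1%:R) /\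
      f%:R * D <= K.*2.+1%:R * potential code w D l].
apply: (@wp_while R J ((n * 16).+1 + 7).+1.+4).
- move=> m [i im x xm] [l [f [[r0 r1 r5 r12] [y0 y3 y4 y5] [imc iml ->]]]].
  move=> [[r4 r2 fF mE] [st fp]] /=; rewrite r0 => un.
  set u := Ordinal un.
  do 5 step; apply: wp_seq.
  apply: (@wp_agree _ _ n (i 2 * n)%N (n * n)%N) => //=.
    by rewrite r12 addn0 r5.
  move=> i' x' fi fx i'4 x'1.
  have i'2 : i' 2%N = i 2%N by rewrite fi.
  have i'1 : i' 1%N = 1%N by rewrite fi.
  have i'5 : i' 5%N = (n * n)%N by rewrite fi.
  have i'7 : i' 7%N = l u by rewrite fi //= r5 -iml.
  have agrE : x' 1%N = agr l u.
    rewrite x'1; apply: eq_bigr => v _.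
    rewrite /capped_agree -(imc u v) -(mw u v) y0 iml r5 (iml u) /=.
    by congr (if _ == _.+1 then _ else _); case: (l u) (l v) => [] [].
  step; apply: wp_if => /=.
    rewrite agrE !fx //= y4 y5 => bad.
    do 5 step.
    (* With D = 0 no vertex is bad, since capped agreements are nonnegative. Positivity allows
       cancelling [D] to bound the number of moves. *)
    have D_gt0 : 0 < D.
      rewrite lt_def D0 andbT; apply/eqP => Dz; move: bad.
      by rewrite Dz mulr0 ltNge mulr_ge0 ?ler0n // sumr_ge0 // => v _;
        rewrite capped_agree_ge0 // -Dz.
    (* With M the capped weight and a the capped agreement at [u], badness gives (2K+1)(M - 2a) >=
       (2K+1)D - 2KD = D. *)
    have fp' : f.+1%:R * D <= K.*2.+1%:R * potential code w D (flip l u).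
      rewrite potential_flip //.
      have := capped_row_ge D0 (w0 u) (Drow u).
      move: fp bad; rewrite -/(agr l u) -addn1 -muln2 natrD natrM.
      set M := \sum_v _; set a := agr l u; set p := potential _ _ _ _.
      move: (ler0n R K); set k := K%:R => k0 fp bad DM; rewrite -natr1.
      have : k * D <= k * M by rewrite ler_wpM2l.
      nra.
    have fF' : (f.+1 <= F)%N.
      rewrite -(ler_nat R) -(ler_pM2r D_gt0); apply: le_trans fp' _.
      have := potential_le code w (flip l u) D0; rewrite card_ord => le.
      by rewrite [F]mulnC natrM -mulrA ler_wpM2l ?ler0n.
    exists ((F - f.+1) * n.+1 + n)%N.
      by rewrite mE (_ : (F - f = (F - f.+1).+1)%N); [nia | lia].
    exists (flip l u), f.+1; split=> //=; first by rewrite !fi.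
    - by rewrite !fx.
    - split=> //; last first.
        move=> v; rewrite fi //= r5 i'2 eqn_add2l /flip -val_eqE /=.
        by case: eqP => // vu; rewrite i'1 i'7 (_ : v = u) ?(subn1) //;
          [case: (l u) | apply: val_inj].
      (* Codes occupy the addresses below n^2 and labels those from n^2 on, so storing a label
         overwrites no code. *)
      move=> x1 x2; rewrite i'5 i'2; case: eqP => [e|//].
      exfalso; have := ltn_ord x1; have := ltn_ord x2; nia.
    - by rewrite subn0.
  rewrite agrE !fx //= y4 y5 -leNgt => good.
  step; exists ((F - f) * n.+1 + (n - (i 2).+1))%N; first by lia.
  exists l, f; split=> //=; first by rewrite !fi.
  - by rewrite !fx.
  - by rewrite i'4 i'2 i'1 addn1 mulSn addnC.
  - split=> // v; rewrite i'2 i'1 addn1 ltnS leq_eqVlt => /predU1P[vu|/st //].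
    by rewrite (_ : v = u) //; apply: val_inj.
- move=> m [i im x xm] [l [f [[r0 r1 r5 r12] _ [imc iml ->]]]].
  move=> [[r4 r2 fF mE] [st fp]] /=; rewrite r0 -leqNgt => nu.
  by apply: (q i im x l) => // u; apply: st; apply: leq_trans nu.
- move: i0 i1 i2 i4 i5 i12 x0 x3 x4 x5 mc mw ml; rewrite /J /agr; case: (s).
  move=> i im x xm /= -> -> -> -> -> -> -> -> -> -> mc mw ml.
  exists (fun=> false), 0%N; split=> //; split=> //; rewrite ?subn0 //.
  by rewrite mul0r mulr_ge0 ?ler0n // potential_ge0.
Qed.

(** * Writing the output *)

Definition copy_labels : program :=
  While (ILt 2 0) (IAdd 6 5 2;; ILoad 7 6;; IStore 2 7;; IAdd 2 2 1).

(** The bound [n <= b] keeps target and source cells apart, so each label is still intact when it is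
    read. The targets may overwrite the codes. *)
Lemma wp_copy_labels (R : realType) (Q : nat -> state R -> Prop) n b T
    (s : state R) :
  (n <= b)%N -> ireg s 0 = n -> ireg s 1 = 1%N -> ireg s 2 = 0%N ->
  ireg s 5 = b ->
  (forall s', (forall v, (v < n)%N -> imem s' v = imem s (b + v)%N) -> Q T s') ->
  wp copy_labels Q ((n * 5).+1 + T) s.
Proof.
move=> nb i0 i1 i2 i5 q.
pose J j (s' : state R) := let: State i im x xm := s' in
  [/\ [/\ i 0 = n, i 1 = 1, i 2 = j & i 5 = b]%N, (j <= n)%N,
      forall v, (v < j)%N -> im v = imem s (b + v)%N &
      forall v, (b <= v)%N -> im v = imem s v].
apply: (@wp_for R J 4 2 0 n).
- by move=> j [i im x xm] /= [[-> _ -> _] jn _ _].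
- move=> j [i im x xm] jn [[r0 r1 r2 r5] _ low high].
  do 4 step; split=> //=; first by rewrite r1 r2 addn1.
    move=> v vj; rewrite r2 r5; case: eqP => [->|vj'].
      by rewrite high // leq_addr.
    by rewrite low //; lia.
  move=> v bv; rewrite r2; case: eqP => [vj|_]; last exact: high.
  by exfalso; lia.
- by move=> [i im x xm] [_ _ low _]; apply: q.
- move: i0 i1 i2 i5; rewrite /J; case: (s) => i im x xm /= *.
  by split.
Qed.

(** * From the memory contents back to the instance *)

(** This is why all labels start at 0, that is, why the search starts from a single cluster without
    any initialization. *)
Lemma row_major_out (T : Type) (x0 : T) (n : nat) (f : 'I_n -> 'I_n -> T) a :
  (n * n <= a)%N -> row_major x0 f a = x0.
Proof.
by move=> le; rewrite /row_major nth_default // size_allpairs size_enum_ord.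
Qed.

Definition edge_code (R : realType) (V : finType) (I : instance R V) (u v : V) :
    nat :=
  if [set u; v] \in pos I then 1%N
  else if [set u; v] \in neg I then 2%N else 0%N.

Definition edge_weight (R : realType) (V : finType) (I : instance R V)
    (u v : V) : R :=
  if [set u; v] \in edge I then weight I [set u; v] else 0.

Lemma edge_weight_ge0 (R : realType) (V : finType) (I : instance R V) u v :
  0 <= edge_weight I u v.
Proof. by rewrite /edge_weight; case: ifP => // /weight_ge0. Qed.

Lemma edge_weight_loop (R : realType) (V : finType) (I : instance R V) u :
  edge_weight I u u = 0.
Proof.
by rewrite /edge_weight; case: ifP => // /edge_card2; rewrite setUid cards1.
Qed.

(** As [pos] and [neg] are disjoint, each vertex contributes to at most one of the two sums in
    [agree]. The merged sum is the uncapped counterpart of [capped_agree]. *)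
Lemma agreeE (R : realType) (V : finType) (I : instance R V) S u :
  agree I S u = \sum_v
    if edge_code I u v == (v \notin pblock S u).+1 then edge_weight I u v else 0.
Proof.
rewrite /agree big_mkcond [X in _ + X]big_mkcond -big_split /=.
apply: eq_bigr => v _; rewrite /edge_code /edge_weight -(pos_neg_cover I) inE.
move: [set u; v] => e.
have : e \in pos I -> (e \in neg I) = false.
  by apply: disjointFr (pos_neg_disjoint I).
case: (e \in pos I) => [/(_ isT)->|_]; case: (v \in _) => //=;
  case: (e \in neg I); by rewrite ?addr0 ?add0r.
Qed.

(** Even in an optimal clustering, the agreement at a vertex is at most the total weight there. *)
Lemma opt_le_row (R : realType) n (I : instance R 'I_n.+1) u :
  opt I <= \sum_v edge_weight I u v.
Proof.
have [S _ ->] := opt_attained I; apply: le_trans (min_agree_le I S u) _.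
rewrite agreeE; apply: ler_sum => v _.
by case: ifP => // _; exact: edge_weight_ge0.
Qed.

(** Capping only lowers weights, and two vertices lie in different blocks exactly when the exclusive
    or of their labels is true. *)
Lemma capped_agree_le_agree (R : realType) (V : finType) (I : instance R V) D
    (f : V -> nat) (l : V -> bool) u :
  (forall v, f v = l v) ->
  \sum_v capped_agree (edge_code I) (edge_weight I) D l u v
    <= agree I (preim_partition f [set: V]) u.
Proof.
move=> fl; rewrite agreeE; apply: ler_sum => v _; rewrite /capped_agree.
rewrite pblock_equivalence_partition ?inE //; last first.
  by split=> // /eqP->.
rewrite !fl (_ : (nat_of_bool (l u) != l v) = l u (+) l v); last first.
  by case: (l u) (l v) => [] [].
by case: ifP => // _; rewrite ge_min lexx.
Qed.

(** * The whole algorithm, its running time and its guarantee *)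

(** The pass over the rows leaves n * n in register 4, which replaces the missing integer
    multiplication. [K] is a constant of the program, so the program depends on eps but not on the
    instance. *)
Definition max_min_agree (K : nat) : program :=
  IConst 1 1;; min_row_loop;;
  IAdd 5 4 12;; IConst 2 0;; IConst 4 0;;
  RConst 4 K;; RConst 5 K.*2.+1;; RMul 4 4 0;; local_search;;
  IConst 2 0;; copy_labels.

(** The expression has the shape that the [wp] rules consume: the pass computing D, then the local
    search, then the copying of labels, with successors for single instructions. *)
Definition max_min_agree_time (K N : nat) : nat :=
  ((N * ((N * 5).+1 + 4).+3).+1 +
   (((N * N * K.*2.+1 * N.+1 + N) * ((N * 16).+1 + 7).+1.+4.+1).+1 +
    ((N * 5).+1 + 0).+1).+1.+4.+1).+1.

(** The local search dominates: at most 7 K N^3 iterations of at most 30 N time units each. The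
    constant 600 leaves room for the other terms. *)
Lemma max_min_agree_time_le K N :
  (0 < K)%N -> (0 < N)%N -> (max_min_agree_time K N <= 600 * K * N ^ 4)%N.
Proof.
move=> K0 N0; rewrite /max_min_agree_time.
have e4 : (N ^ 4 = N * N * (N * N))%N by rewrite !expnS expn0 muln1 !mulnA.
have b1 : (N <= N * N)%N by nia.
have b2 : (N * N <= N * N * N)%N by nia.
have b3 : (N * N * N <= N * N * (N * N))%N by nia.
have b4 : (N * N * (N * N) <= K * (N * N * (N * N)))%N by nia.
have it : (N * N * K.*2.+1 * N.+1 + N <= 7 * (K * (N * N * N)))%N.
  have : (K.*2.+1 <= 3 * K)%N by lia.
  have : (N.+1 <= 2 * N)%N by lia.
  nia.
have := leq_mul it (_ : ((N * 16).+1 + 7).+1.+4.+1 <= 30 * N)%N.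
move=> /(_ ltac:(lia)) => it2.
rewrite e4; nia.
Qed.

Lemma max_min_agree_correct (R : realType) K n (I : instance R 'I_n.+1) :
  (0 < K)%N ->
  exists t s, [/\ exec (max_min_agree K) (init I) t s,
    (t <= 600 * K * n.+1 ^ 4)%N &
    forall u, K%:R * opt I <= agree I (output n.+1 s) u * K.*2.+1%:R].
Proof.
move=> K0; set N := n.+1.
pose Q (T : nat) (s : state R) :=
  forall u, K%:R * opt I <= agree I (output N s) u * K.*2.+1%:R.
have [t [s [T' [e le q]]]] : wp (max_min_agree K) Q
    (max_min_agree_time K N) (init I).
  step; apply: wp_seq; apply: (@wp_min_row _ _ N) => //=.
  move=> i x fi fx i4 xmin [u0 u0N xu0].
  have rowE (u : 'I_N) : \sum_(v < N) row_major 0 (edge_weight I) (u * N + v)%N =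
      \sum_v edge_weight I u v.
    by apply: eq_bigr => v _; rewrite row_majorE.
  do 6 step; apply: wp_seq.
  have x0E : x 0%N = \sum_v edge_weight I (Ordinal u0N) v by rewrite xu0 -rowE.
  apply: (@wp_local_search _ _ N K _ (edge_code I) (edge_weight I) (x 0%N)) => //=.
  - by rewrite x0E sumr_ge0 // => v _; exact: edge_weight_ge0.
  - by move=> u v; rewrite /edge_code setUC.
  - by move=> u v; rewrite /edge_weight setUC.
  - move=> u v; rewrite /edge_code /edge_weight -(pos_neg_cover I) inE.
    by case: ([set u; v] \in pos I); case: ([set u; v] \in neg I).
  - exact: edge_weight_loop.
  - exact: edge_weight_ge0.
  - by move=> u; rewrite -rowE; apply: xmin.
  - by rewrite fi.
  - by rewrite fi.
  - by rewrite i4 fi // addn0.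
  - by rewrite fi.
  - by rewrite fx.
  - by move=> u v; rewrite row_majorE.
  - by move=> u v; rewrite row_majorE.
  - by move=> v; rewrite row_major_out // leq_addr.
  move=> i' im x' l i'0 i'1 i'5 iml st; step.
  apply: (@wp_copy_labels _ _ N (N * N)) => //=; first by rewrite leq_pmulr.
  (* The chain is K OPT <= K D <= (2K+1) times the capped agreement <= (2K+1) times the
     agreement. *)
  move=> s out u; apply: (@le_trans _ _ (K%:R * x 0%N)).
    by rewrite ler_wpM2l // x0E opt_le_row.
  apply: le_trans (st u) _; rewrite ler_wpM2r //.
  by apply: capped_agree_le_agree => v; rewrite out.
exists t, s; split=> //; apply: leq_trans (leq_addr T' t) _.
exact: leq_trans le (max_min_agree_time_le _ _).
Qed.

Theorem theorem5 (R : realType) :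
  exists p : {poly {poly R}},
  forall eps : R, 0 < eps ->
  exists P : program,
  forall (n : nat) (I : instance R 'I_n.+1),
  exists (t : nat) (s : state R),
    [/\ exec P (init I) t s,
        t%:R <= p.[n.+1%:R%:P].[eps^-1],
        clustering (output n.+1 s) &
        (2 + eps)^-1 * opt I <= min_agree I (output n.+1 s)].
Proof.
(* The outer variable stands for the number of vertices and the inner one for 1 / eps; the factor
   ['X + 1] bounds [K]. *)
exists ((600%:R *: ('X + 1))%:P * 'X^4) => eps eps0.
(* The successor makes [K] exceed 1 / eps, for the ratio, while [K] stays at most 1 / eps + 1, for
   the running time. *)
pose K := (Num.trunc eps^-1).+1; exists (max_min_agree K) => n I.
have epsV0 : 0 <= eps^-1 by rewrite invr_ge0 ltW.
have Kgt : eps^-1 < K%:R by exact: truncnS_gt.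
have Kle : K%:R <= eps^-1 + 1.
  by rewrite -natr1 lerD2r truncn_le.
have [//|t [s [e tle st]]] := @max_min_agree_correct R K n I.
exists t, s; split=> //; last 2 first.
- exact: preim_partitionP.
- have [u ->] := min_agree_attained I (output n.+1 s).
  rewrite mulrC ler_pdivrMr ?addr_gt0 //.
  have := st u; set a := agree _ _ _ => le.
  have K0 : 0 < K%:R :> R by rewrite ltr0n.
  have a0 : 0 <= a.
    rewrite /a agreeE sumr_ge0 // => v _.
    by case: ifP => // _; exact: edge_weight_ge0.
  rewrite -(ler_pM2l K0); apply: le_trans le _.
  (* Since [a] is nonnegative, this gives a (2K + 1) <= K a (2 + eps). *)
  have Ke : 1 <= K%:R * eps.
    by rewrite -ler_pdivrMr // mul1r ltW.
  rewrite -addn1 -muln2 natrD natrM; nra.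
rewrite !hornerE /=.
have : t%:R <= (600 * K * n.+1 ^ 4)%N%:R :> R by rewrite ler_nat.
move=> /le_trans; apply; rewrite natrM natrX natrM.
by rewrite !exprS expr0 mulr1 !mulrA !ler_wpM2r // ler_wpM2l // ler0n.
Qed.
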